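(* Let $n\ge3$ be an integer and let $r$ be a positive integer. Let $T=[C_n,\{f_{v_i}\}_{i=1}^n,\mathrm{id}]\colon\mathbb F_2^n\to\mathbb F_2^n$, where $f_{v_i}\in\{\mathrm{parity}_3,(1+\mathrm{parity})_3\}$ for all $i$. If $T$ has a fixed point, then \[|\mathrm{Per}_r(T)|=\begin{cases}\sum_{d\mid r}\mu(r/d)2^{d+1}, & \text{if } r\mid n-1\text{ and } n\equiv0\pmod2;\\ \sum_{d\mid r}\mu(r/d)\xi_n(d), & \text{if } r\mid 2n-2 \text{ and } n\equiv 1\pmod 2;\\ 0, & \text{otherwise}.\end{cases}\] If $T$ does not have a fixed point, then \[|\mathrm{Per}_r(T)|=\begin{cases}\sum_{d\mid_o r}\mu(r/d)2^{\frac d2+1}, & \text{if } r\mid_o 2n-2;\\ 0, & \text{otherwise}.\end{cases}\]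
   Context: $C_n$ is the cycle graph with vertices $v_1,\dots,v_n$, $v_i$ adjacent to $v_j$ iff $i-j\equiv\pm1\pmod n$. $\mathrm{parity}_3(x,y,z)=x+y+z$ and $(1+\mathrm{parity})_3(x,y,z)=1+x+y+z$ over $\mathbb F_2$. For $x=(x_1,\dots,x_n)\in\mathbb F_2^n$, the local update $F_{v_i}$ replaces $x_i$ by $f_{v_i}(x_{i-1},x_i,x_{i+1})$ (indices mod $n$) and leaves other coordinates unchanged; $T=[C_n,\{f_{v_i}\},\mathrm{id}]=F_{v_n}\circ\cdots\circ F_{v_1}$. A point $x$ is a periodic point of $T$ of period $r$ if $T^r(x)=x$ and $T^s(x)\ne x$ for all positive $s<r$; $\mathrm{Per}_r(T)$ is the set of such points. $\mu$ is the number-theoretic Möbius function. For nonzero integers $k,m$, $k\mid_o m$ means $m/k$ is an odd integer, and $\sum_{d\mid_o r}$ runs over positive $d$ with $r/d$ odd. For a positive integer $k$, $\xi_n(k)=2^k$ if $k\mid n-1$ and $\xi_n(k)=2^{\frac k2+1}$ if $k\nmid n-1$. *)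

(* Defs.v *)
From mathcomp Require Import all_boot all_order all_fingroup all_algebra.

Set Implicit Arguments.
Unset Strict Implicit.
Unset Printing Implicit Defensive.

Import GRing.Theory.
Local Open Scope ring_scope.

Definition parity3 (x y z : 'F_2) : 'F_2 := x + y + z.

Definition one_plus_parity3 (x y z : 'F_2) : 'F_2 := 1 + x + y + z.

(* The vertex v_i of C_n is the ordinal of value i - 1; its neighbours are     *)
(* [ord_pred i] and [ordS i], the cyclic predecessor and successor.            *)
Definition local_update n (f : 'I_n -> 'F_2 -> 'F_2 -> 'F_2 -> 'F_2)
    (i : 'I_n) (x : 'rV['F_2]_n) : 'rV['F_2]_n :=
  \row_j (if j == i then f i (x 0 (ord_pred i)) (x 0 i) (x 0 (ordS i))
          else x 0 j).

(* [enum 'I_n] is increasing and [foldl] applies the update at its head first, *)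
(* so this is F_{v_n} \o ... \o F_{v_1}.                                       *)
Definition cycle_sds n (f : 'I_n -> 'F_2 -> 'F_2 -> 'F_2 -> 'F_2)
    (x : 'rV['F_2]_n) : 'rV['F_2]_n :=
  foldl (fun y i => local_update f i y) x (enum 'I_n).

Definition Per (X : finType) (T : X -> X) (r : nat) : {set X} :=
  [set x | (iter r T x == x)
           && [forall s : 'I_r, (0 < s)%N ==> (iter s T x != x)]].

Definition moebius (n : nat) : int :=
  if (0 < n)%N && all (fun p => logn p n == 1%N) (primes n)
  then (-1) ^+ size (primes n) else 0.

(* k |_o m : the quotient m / k is an odd integer. *)
Definition odd_dvdn (k m : nat) : bool := (k %| m)%N && odd (m %/ k).

(* The exponent k/2 + 1 uses the natural-number quotient: this is exact on the *)
(* divisors k of 2n - 2, since such a k is even when it does not divide n - 1. *)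
Definition xi (n k : nat) : int :=
  if (k %| n - 1)%N then 2 ^+ k else 2 ^+ (k %/ 2 + 1).

(* Main.v *)
(* Pass to the edges e_i = x_i + x_(i+1).  The update of a vertex swaps its two
   edges, up to an additive constant, so that one turn of T cyclically shifts
   n - 1 of the edges.  Equivalently, an orbit is a sequence a with
   a (m + n) = a (m + n - 1) + a m + a (m + 1) + c m, whose edge sequence b
   satisfies b (m + n - 1) = b m + c m, and T^k x = x means that a has period
   k n.  This gives T^(2n-2) = 1.

   T is affine, with linear part L given by c = 0, so a nonempty Fix (T^k) has as
   many points as Fix (L^k).  If d | n - 1 then Fix (L^d) consists of the a whose
   edges have period d when n is even, and of the a of period d when n is odd;
   if d | 2n - 2 but d does not divide n - 1, it consists of the a whose edges
   have period d / 2.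

   A map which is affine over F_2 and has a point of odd period q has a fixed
   point, namely the sum of the q points of the orbit.  Hence T^d has a fixed
   point when (2n - 2) / d is odd.  Conversely a fixed point of T^(n-1) produces
   one of T: by the same argument for n even, and for n odd because it forces the
   sum of the constants to vanish, which makes the fixed point equations
   x_(i-1) + x_(i+1) = c_i solvable.  Moebius inversion concludes. *)

Require Import Defs.
From mathcomp Require Import all_boot all_order all_fingroup all_algebra.
From mathcomp Require Import ring zify.

Set Implicit Arguments.
Unset Strict Implicit.
Unset Printing Implicit Defensive.

Import GRing.Theory.
Local Open Scope ring_scope.

(** * The Moebius function and its divisor sum *)

Lemma moebius_pM p m : prime p -> (0 < m)%N -> ~~ (p %| m)%N ->
  moebius (p * m) = - moebius m.
Proof.
move=> p_pr m0 pm; have p0 := prime_gt0 p_pr.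
have primes_pm : perm_eq (primes (p * m)) (p :: primes m).
  apply: uniq_perm; rewrite ?primes_uniq //=.
    by rewrite primes_uniq mem_primes (negPf pm) !andbF.
  by move=> q; rewrite primesM // primes_prime // inE orbC inE orbC.
rewrite /moebius muln_gt0 p0 m0 /= (perm_all _ primes_pm) (perm_size primes_pm) /=.
rewrite lognM // logn_prime // eqxx (lognE p m) (negPf pm) !andbF addn0 /=.
have -> : all (fun q => logn q (p * m) == 1)%N (primes m)
        = all (fun q => logn q m == 1)%N (primes m).
  apply: eq_in_all => q; rewrite mem_primes => /and3P[q_pr _ qm].
  rewrite lognM // logn_prime //; case: (q =P p) => // eq_pq.
  by case/negP: pm; move: qm; rewrite eq_pq.
by case: all; rewrite ?oppr0 // exprS mulN1r.
Qed.

Lemma moebius_sqr p m : prime p -> (0 < m)%N -> (p ^ 2 %| m)%N -> moebius m = 0.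
Proof.
move=> p_pr m0; rewrite pfactor_dvdn // => lt1.
rewrite /moebius m0 /=; case: allP => // /(_ p).
rewrite -logn_gt0 => /(_ (ltnW lt1)) /eqP eq1.
by rewrite eq1 in lt1.
Qed.

(* The terms divisible by p^2 vanish, where p is a prime divisor of m; the others
   cancel in pairs d, p d. *)
Lemma sum_moebius m : (0 < m)%N ->
  \sum_(d <- divisors m) moebius d = (m == 1%N)%:R.
Proof.
move=> m0; case: eqVneq => [->|m_neq1].
  by rewrite big_seq1.
have m1 : (1 < m)%N by case: m m0 m_neq1 => [|[]].
pose p := pdiv m; have p_pr : prime p := pdiv_prime m1.
have p0 := prime_gt0 p_pr; have pm : (p %| m)%N := pdiv_dvd m.
rewrite (bigID (fun d => p %| d)%N) /=.
rewrite (bigID (fun d => p ^ 2 %| d)%N) /= big1_seq ?add0r; last first.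
  move=> d /andP[/andP[_ p2d]]; rewrite -dvdn_divisors // => dm.
  by apply: moebius_sqr p2d => //; exact: dvdn_gt0 dm.
have perm_p : perm_eq [seq d <- divisors m | (p %| d)%N && ~~ (p ^ 2 %| d)%N]
    [seq (p * d)%N | d <- divisors m & ~~ (p %| d)%N].
  apply: uniq_perm; first by rewrite filter_uniq ?divisors_uniq.
    rewrite map_inj_uniq ?filter_uniq ?divisors_uniq // => d e /eqP.
    by rewrite eqn_pmul2l // => /eqP.
  move=> d; rewrite mem_filter -dvdn_divisors //.
  apply/idP/mapP => [/andP[/andP[pd p2d] dm]|[e]].
    case/dvdnP: pd p2d dm => e ->; rewrite mulnC => p2d dm.
    exists e => //; rewrite mem_filter -dvdn_divisors //.
    by rewrite -(dvdn_pmul2l p0) p2d (dvdn_trans _ dm) // dvdn_mull.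
  rewrite mem_filter -dvdn_divisors // => /andP[pe em] ->.
  rewrite dvdn_mulr // dvdn_pmul2l // pe /=.
  by rewrite Gauss_dvd ?pm // prime_coprime.
rewrite -big_filter (perm_big _ perm_p) big_map big_filter /= -big_split /=.
rewrite big_seq_cond big1 // => d /andP[]; rewrite -dvdn_divisors // => dm pd.
by rewrite moebius_pM ?addNr //; exact: dvdn_gt0 dm.
Qed.

Lemma perm_divisors_div m : (0 < m)%N ->
  perm_eq [seq (m %/ d)%N | d <- divisors m] (divisors m).
Proof.
move=> m0; have divK d : d \in divisors m -> (m %/ (m %/ d))%N = d.
  by rewrite -dvdn_divisors // => dm; rewrite divnA // mulKn.
have div_in d : d \in divisors m -> (m %/ d)%N \in divisors m.
  rewrite -!dvdn_divisors // => /dvdnP[q def_m].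
  have d0 : (0 < d)%N by move: m0; rewrite def_m muln_gt0 => /andP[].
  by rewrite def_m mulnK // dvdn_mulr.
apply: uniq_perm; rewrite ?divisors_uniq //.
  by rewrite map_inj_in_uniq ?divisors_uniq //; exact: can_in_inj divK.
move=> d; apply/mapP/idP => [[e em ->]|dm]; first exact: div_in.
by exists (m %/ d)%N; rewrite ?divK ?div_in.
Qed.

(** * Points of exact period, by Moebius inversion *)

Section Periods.
Variables (X : finType) (T : X -> X).

Definition fixpts k : {set X} := [set x | iter k T x == x].

Lemma iter_mul_fix k q x : iter k T x = x -> iter (q * k) T x = x.
Proof. by move=> Tx; elim: q => //= q IH; rewrite mulSn iterD IH. Qed.

Lemma fixpts_dvd k m : (k %| m)%N -> fixpts k \subset fixpts m.
Proof.
case/dvdnP=> q ->; apply/subsetP => x; rewrite !inE => /eqP Tx.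
by rewrite iter_mul_fix.
Qed.

Lemma least_period x r : (0 < r)%N -> iter r T x = x ->
  {s | (0 < s)%N & forall k, (iter k T x == x) = (s %| k)%N}.
Proof.
move=> r0 Tr.
have ex : exists s, (0 < s)%N && (iter s T x == x).
  by exists r; rewrite r0 Tr eqxx.
case: (ex_minnP ex) => s /andP[s0 /eqP Ts] min_s; exists s => // k.
apply/eqP/idP => [|/dvdnP[q ->]]; last exact: iter_mul_fix.
rewrite {1}(divn_eq k s) addnC iterD iter_mul_fix // => Tk.
rewrite /dvdn; case: posnP => [//|mod0].
by have := min_s (k %% s)%N; rewrite mod0 Tk eqxx leqNgt ltn_pmod // => /(_ isT).
Qed.

Lemma Per_least_period x r s : (0 < r)%N ->
  (forall k, (iter k T x == x) = (s %| k)%N) -> (x \in Per T r) = (r == s).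
Proof.
move=> r0 Ts; rewrite inE Ts; apply/andP/eqP => [[sr /forallP min_r]|->].
  apply/eqP; rewrite eqn_leq (dvdn_leq r0 sr) andbT leqNgt; apply/negP => lt_sr.
  have := min_r (Ordinal lt_sr); rewrite /= Ts dvdnn (dvdn_gt0 r0 sr).
  by [].
split=> //; apply/forallP => k; apply/implyP => k0.
by rewrite Ts gtnNdvd.
Qed.

(** Both sides are compared point by point. A point whose least period [s] divides [r] contributes
    on the right the sum of [moebius] over the divisors of [r %/ s], which is 1 if [s = r] and 0
    otherwise; a point not fixed by the [r]-th iterate contributes nothing. *)
Lemma card_Per r : (0 < r)%N ->
  #|Per T r|%:Z = \sum_(d <- divisors r) moebius (r %/ d) * #|fixpts d|%:Z.
Proof.
move=> r0.
have cardE (A : {set X}) : #|A|%:Z = \sum_x (x \in A)%:R.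
  rewrite -[LHS]natz -sum1_card natr_sum big_mkcond /=.
  by apply: eq_bigr => x _; case: ifP.
under eq_bigr => d _ do rewrite cardE mulr_sumr.
rewrite cardE exchange_big /=; apply: eq_bigr => x _.
have [/eqP Tr|Tr] := boolP (iter r T x == x); last first.
  rewrite inE (negPf Tr) big1_seq // => d /=; rewrite -dvdn_divisors // => dr.
  suff /negPf-> : x \notin fixpts d by rewrite mulr0.
  by apply: contra Tr => /(subsetP (fixpts_dvd dr)); rewrite inE.
have [s s0 Ts] := least_period r0 Tr.
have sr : (s %| r)%N by rewrite -Ts Tr.
rewrite (Per_least_period r0 Ts).
have rs0 : (0 < r %/ s)%N by rewrite divn_gt0 // dvdn_leq.
transitivity (\sum_(d <- divisors (r %/ s)) moebius d).
  rewrite (sum_moebius rs0); congr (nat_of_bool _)%:R.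
  by rewrite -[RHS](eqn_pmul2r s0) divnK // mul1n.
have perm_s : perm_eq (divisors (r %/ s)) [seq d <- divisors r | (s %| r %/ d)%N].
  apply: uniq_perm; rewrite ?filter_uniq ?divisors_uniq // => d.
  rewrite mem_filter -(dvdn_divisors _ rs0) -(dvdn_divisors _ r0).
  apply/idP/andP => [d_rs|[s_rd dr]].
    have dr : (d %| r)%N by exact: dvdn_trans d_rs (dvdn_div sr).
    by rewrite (dvdn_divRL _ dr) mulnC -(dvdn_divRL _ sr).
  by rewrite (dvdn_divRL _ sr) mulnC -(dvdn_divRL _ dr).
rewrite (perm_big _ perm_s) big_filter /=.
rewrite -(perm_big _ (perm_divisors_div r0)) /= big_map.
rewrite big_mkcond /= big_seq [RHS]big_seq; apply: eq_bigr => d.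
rewrite -(dvdn_divisors _ r0) => dr.
rewrite inE Ts divnA // mulKn //; case: ifP; rewrite ?mulr1 ?mulr0 //.
Qed.

End Periods.

(** * Periodic sequences and sums over one period *)

Section PeriodicSequences.
Variable V : zmodType.
Implicit Types g : nat -> V.

Definition periodic e g := forall m, g (m + e)%N = g m.

Lemma periodicM e q g : periodic e g -> periodic (q * e) g.
Proof.
move=> ge; elim: q => [|q IH] m; first by rewrite addn0.
by rewrite mulSn addnA IH ge.
Qed.

Lemma periodic_modn e g m : periodic e g -> g (m %% e)%N = g m.
Proof. by move=> ge; rewrite {2}(divn_eq m e) addnC periodicM. Qed.

(** A Euclidean step: a period can be reduced modulo another one. *)
Lemma periodic_cancel p q g : periodic p g -> periodic (p + q) g -> periodic q g.
Proof. by move=> gp gpq m; rewrite -gp -addnA (addnC q) gpq. Qed.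

(** For [u] prime to [n], the map sending i to m + i u permutes the residues modulo [n]. *)
Lemma sum_periodic_coprime n u m g : (0 < n)%N -> coprime n u -> periodic n g ->
  \sum_(i < n) g (m + i * u)%N = \sum_(i < n) g i.
Proof.
move=> n0 co_nu gn; pose h (i : 'I_n) := Ordinal (ltn_pmod (m + i * u)%N n0).
have h_le i j : h i = h j -> (i <= j)%N -> i = j.
  move=> /(congr1 val)/= /eqP; rewrite eqn_modDl => eq_ij le_ij.
  apply: val_inj; apply/eqP; rewrite eqn_leq le_ij -subn_eq0 /=.
  move: eq_ij; rewrite eq_sym eqn_mod_dvd ?leq_mul2r ?le_ij ?orbT // -mulnBl.
  rewrite Gauss_dvdl //; apply: contraTT; rewrite -lt0n => ij.
  by rewrite gtnNdvd // (leq_ltn_trans (leq_subr _ _)).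
have h_inj : injective h.
  move=> i j hij; case/orP: (leq_total i j) => le_ij; first exact: h_le.
  by apply/esym; apply: h_le.
rewrite [RHS](reindex_inj h_inj); apply: eq_bigr => i _.
by rewrite periodic_modn.
Qed.

Lemma sum_periodic_mul n q m g : (0 < n)%N -> periodic n g ->
  \sum_(i < q * n) g (m + i)%N = (\sum_(i < n) g i) *+ q.
Proof.
move=> n0 gn; elim: q => [|q IH]; first by rewrite big_ord0.
rewrite -addn1 mulnDl mul1n big_split_ord /= IH mulrnDr mulr1n; congr (_ + _).
rewrite -[RHS](@sum_periodic_coprime n 1 m) ?coprimen1 //.
by apply: eq_bigr => i _; rewrite muln1 addnCA -[RHS](periodicM q gn) addnC.
Qed.

End PeriodicSequences.

Lemma F2_addxx (x : 'F_2) : x + x = 0.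
Proof. by case: x => [[|[|]]] // ?; apply/val_inj. Qed.

(** * Orbits as solutions of a single recurrence *)

Section OrbitSequences.
Variable n' : nat.
Hypothesis n'_gt0 : (0 < n')%N.
Local Notation n := n'.+1.
Implicit Types (a c : nat -> 'F_2) (x y : 'rV['F_2]_n).

(** The term [a (i + k * n)] is the state of vertex i after k turns. When vertex i is updated, its
    left neighbour is [n'] places further on and its right neighbour one place further on, at the
    two ends of the cycle as well. *)
Definition orbit_rec c a :=
  forall m, a (m + n)%N = a (m + n')%N + a m + a m.+1 + c m.

Definition window a k : 'rV['F_2]_n := \row_i a (i + k)%N.

Lemma orbit_rec_shift c a k : periodic k c -> orbit_rec c a ->
  orbit_rec c (fun m => a (m + k)%N).
Proof.
by move=> ck ac m; rewrite addnAC ac ck addnAC addSn.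
Qed.

Lemma orbit_rec_uniq c a1 a2 : orbit_rec c a1 -> orbit_rec c a2 ->
  window a1 0 = window a2 0 -> a1 =1 a2.
Proof.
move=> rec1 rec2 /rowP w12 m; elim/ltn_ind: m => m IH.
have [lt_mn|le_nm] := ltnP m n.
  by have := w12 (Ordinal lt_mn); rewrite !mxE addn0.
by rewrite -(subnK le_nm) rec1 rec2 !IH //; lia.
Qed.

Lemma orbit_rec_exists c x : {a | orbit_rec c a & window a 0 = x}.
Proof.
(* A shift register: [w k] holds the terms from position [k] on in its first [n] cells, so the
   sequence is read off at cell 0. *)
pose step k (w : nat -> 'F_2) i :=
  if i == n' then w n' + w 0 + w 1 + c k else w i.+1.
pose w := fix w k := if k is j.+1 then step j (w j)
                     else (fun i => x 0 (inord i)).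
have wE k i : (i < n)%N -> w k i = w (k + i)%N 0.
  elim: i k => [|i IH] k lt_in; first by rewrite addn0.
  rewrite addnS -addSn -IH ?(ltnW lt_in) //= /step ifN //; lia.
exists (fun k => w k 0).
  move=> m; have <- : w m n' = w (m + n')%N 0 by exact: wE.
  have <- : w m 1%N = w m.+1 0 by rewrite wE ?addn1.
  have <- : w m.+1 n' = w (m + n)%N 0 by rewrite wE ?addSnnS.
  by rewrite /= /step eqxx.
apply/rowP => i; rewrite !mxE addn0.
by rewrite -(wE 0%N i (ltn_ord i)) /= inord_val.
Qed.

Section Dynamics.
Variables (f : 'I_n -> 'F_2 -> 'F_2 -> 'F_2 -> 'F_2) (c : nat -> 'F_2).
Hypothesis fE : forall (i : 'I_n) (x y z : 'F_2), f i x y z = c i + x + y + z.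
Local Notation T := (cycle_sds f).

Lemma cycle_sds_window a : orbit_rec c a -> T (window a 0) = window a n.
Proof.
(* [W k] is the state once the first [k] vertices of the turn have been updated. *)
move=> rec_a; pose W k : 'rV['F_2]_n := \row_j a (if (j < k)%N then j + n else j)%N.
have W0 : window a 0 = W 0 by apply/rowP => j; rewrite !mxE addn0.
have Wn : window a n = W n by apply/rowP => j; rewrite !mxE ltn_ord.
have WS (i : 'I_n) : local_update f i (W i) = W i.+1.
  apply/rowP => j; rewrite !mxE ltnS; case: eqVneq => [->|neq_ji]; last first.
    suff -> : (j <= i)%N = (j < i)%N by [].
    by rewrite leq_eqVlt (inj_eq val_inj) (negPf neq_ji).
  rewrite leqnn ltnn fE rec_a /=.
  (* The predecessor is already updated, except that of vertex 0, which is the last vertex and still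
     sits at position [n']. *)
  have -> : a (if ((i + n).-1 %% n < i)%N then (i + n).-1 %% n + n
               else (i + n).-1 %% n)%N = a (i + n')%N.
    rewrite addnS /=; case: (posnP i) => [->|i0].
      by rewrite modn_small.
    have -> : (i + n' = i.-1 + n)%N by lia.
    by rewrite modnDr modn_small ?ifT //; have := ltn_ord i; lia.
  (* The successor is not yet updated, except that of the last vertex, which is vertex 0 and now
     sits at position [n]. *)
  have -> : a (if (i.+1 %% n < i)%N then i.+1 %% n + n else i.+1 %% n)%N = a i.+1.
    have [->|neq_in] := eqVneq (val i) n'; first by rewrite modnn n'_gt0.
    have lt_in : (i.+1 < n)%N by rewrite ltnS ltn_neqAle neq_in -ltnS ltn_ord.
    by rewrite modn_small // ltnNge leqnSn.
  ring.
suff W_take k : (k <= n)%N ->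
    foldl (fun y i => local_update f i y) (W 0%N) (take k (enum 'I_n)) = W k.
  by rewrite /cycle_sds W0 Wn -(W_take n) ?take_oversize ?size_enum_ord.
elim: k => [|k IH] lt_kn; first by rewrite take0.
rewrite (take_nth ord0) ?size_enum_ord // -cats1 foldl_cat IH ?(ltnW lt_kn) //=.
by rewrite -[in W k](nth_enum_ord ord0 lt_kn) WS nth_enum_ord.
Qed.

Hypothesis c_per : periodic n c.

Lemma iter_cycle_sds_window k a : orbit_rec c a ->
  iter k T (window a 0) = window a (k * n).
Proof.
elim: k a => [|k IH] a rec_a //; rewrite iterSr cycle_sds_window //.
have -> : window a n = window (fun m => a (m + n)%N) 0.
  by apply/rowP => i; rewrite !mxE addn0.
rewrite IH; last exact: orbit_rec_shift.
by apply/rowP => i; rewrite !mxE mulSn addnAC addnA.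
Qed.

(** Shifting by [k * n] preserves the recurrence, and a solution is determined by its first window;
    equality of two windows therefore extends to the whole sequence. *)
Lemma iter_cycle_sds_fix k a : orbit_rec c a ->
  iter k T (window a 0) = window a 0 <-> periodic (k * n) a.
Proof.
move=> rec_a; rewrite iter_cycle_sds_window //; split=> [|a_per].
  have -> : window a (k * n) = window (fun m => a (m + k * n)%N) 0.
    by apply/rowP => i; rewrite !mxE addn0.
  by apply: orbit_rec_uniq => //; apply/orbit_rec_shift/rec_a/periodicM.
by apply/rowP => i; rewrite !mxE a_per addn0.
Qed.

End Dynamics.

(** * Edge sequences and the sum of the constants *)

Definition edge a m := a m + a m.+1.

Lemma edge_sum a m k : a (m + k)%N = a m + \sum_(i < k) edge a (m + i)%N.
Proof.
elim: k => [|k IH]; first by rewrite big_ord0 addr0 addn0.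
rewrite big_ord_recr /= addrA -IH addnS /edge addrA F2_addxx add0r //.
Qed.

Lemma edge_periodic e a : periodic e a -> periodic e (edge a).
Proof. by move=> ae m; rewrite /edge -addSn !ae. Qed.

Lemma edge_rec c a m : orbit_rec c a -> edge a (m + n')%N = edge a m + c m.
Proof.
move=> rec_a; rewrite /edge -addnS rec_a !addrA F2_addxx add0r //.
Qed.

Lemma edge_rec_mul c a m q : orbit_rec c a ->
  edge a (m + q * n')%N = edge a m + \sum_(i < q) c (m + i * n')%N.
Proof.
move=> rec_a; elim: q => [|q IH]; first by rewrite big_ord0 addn0 addr0.
by rewrite mulSnr addnA (edge_rec _ rec_a) IH big_ord_recr /= addrA.
Qed.

(** In [n] steps of length [n'], which is prime to [n], every constant is collected exactly once. *)
Lemma edge_turn c a m : orbit_rec c a -> periodic n c ->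
  edge a (m + n' * n)%N = edge a m + \sum_(i < n) c i.
Proof.
move=> rec_a c_per; rewrite mulnC (edge_rec_mul _ _ rec_a).
by rewrite sum_periodic_coprime // coprimeSn.
Qed.

(** The increment of [a] is a sum of edges over two stretches of length [n' * n]. Paired edges
    differ by the sum of the constants, so [n' * n] copies of that sum remain, an even number. *)
Lemma orbit_periodic c a : orbit_rec c a -> periodic n c ->
  periodic (n'.*2 * n) a.
Proof.
move=> rec_a c_per m; rewrite edge_sum -addnn mulnDl big_split_ord /=.
rewrite -big_split /=.
under eq_bigr => i _ do
  rewrite [(n' * n + i)%N]addnC addnA (edge_turn _ rec_a c_per) addrA F2_addxx add0r.
rewrite sumr_const card_ord.
suff -> : (n' * n = (n' * n)./2 + (n' * n)./2)%N.
  by rewrite mulrnDr -mulrnDl F2_addxx mul0rn addr0.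
by rewrite addnn even_halfK // oddM /= andbN.
Qed.

Lemma turn_fix_charge c a : orbit_rec c a -> periodic n c ->
  periodic (n' * n) a -> \sum_(i < n) c i = 0.
Proof.
move=> rec_a c_per /edge_periodic/(_ 0%N).
by rewrite (edge_turn _ rec_a c_per) => /(canRL (addKr _)) ->; rewrite addNr.
Qed.

(* [n'./2.+1] inverts [2] modulo the odd number [n]. *)
Lemma charge0_fix c : ~~ odd n' -> periodic n c -> \sum_(i < n) c i = 0 ->
  {a | orbit_rec c a & periodic n a}.
Proof.
move=> n'_even c_per c0; have def_n' := even_halfK n'_even.
(* [s t] is the value at position 2t of the solution of a (m + 2) = a m + c (m + 1) with a 0 = 0.
   The vanishing of the sum of the constants closes it up after [n] steps. *)
pose s t := \sum_(i < t) c (1 + i * 2)%N.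
have s_per : periodic n s.
  move=> t; rewrite /s addnC big_split_ord /=.
  rewrite sum_periodic_coprime ?coprimen2 //= c0 add0r; apply: eq_bigr => i _.
  by rewrite mulnDl addnCA addnC [(n * 2)%N]mulnC periodicM.
pose a m := s (m * n'./2.+1)%N.
have a_per : periodic n a.
  by move=> m; rewrite /a mulnDl mulnC [(n * _)%N]mulnC periodicM // mulnC.
have a2 m : a m.+2 = a m + c m.+1.
  rewrite /a; have -> : (m.+2 * n'./2.+1 = (m * n'./2.+1).+1 + n)%N by lia.
  rewrite s_per /s big_ord_recr /=; congr (_ + _).
  by have -> : (1 + m * n'./2.+1 * 2 = m.+1 + m * n)%N; [lia | rewrite periodicM].
exists a => // m; rewrite a_per.
have -> : a m.+1 = a (m + n')%N + c m.
  by rewrite -[a m.+1]a_per addSnnS !addnS a2 -addnS c_per.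
rewrite -[LHS]add0r -(F2_addxx (a (m + n')%N)) -[LHS]addr0 -(F2_addxx (c m)); ring.
Qed.

End OrbitSequences.

(** * Counting the fixed points of the iterates of the linear part *)

Section LinearCount.
Variable n' : nat.
Hypothesis n'_gt0 : (0 < n')%N.
Local Notation n := n'.+1.
Implicit Types a : nat -> 'F_2.
Local Notation linear_rec := (orbit_rec n' (fun=> 0)).
Local Notation L := (cycle_sds (fun _ : 'I_n => parity3)).

Lemma edge_orbit_rec a : periodic n' (edge a) -> linear_rec a.
Proof.
move=> per_a m; have := per_a m; rewrite /edge -addnS => def_a.
by rewrite addr0 -addrA -def_a addrA F2_addxx add0r.
Qed.

Lemma linear_edge_periodic a : linear_rec a -> periodic n' (edge a).
Proof. by move=> rec_a m; rewrite (edge_rec _ rec_a) addr0. Qed.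

Lemma edge_periodic_sum q e a m : (0 < e)%N -> periodic e (edge a) ->
  a (m + q * e)%N = a m + (\sum_(i < e) edge a i) *+ q.
Proof. by move=> e0 per_a; rewrite edge_sum sum_periodic_mul. Qed.

Lemma F2_mulrn (x : 'F_2) q : x *+ q = x *+ odd q.
Proof.
rewrite -{1}(odd_double_half q) mulrnDr -mul2n mulrnA mulr2n F2_addxx mul0rn.
by rewrite addr0.
Qed.

(** The edges have period [n'], and d n = d n' + d. *)
Lemma linear_edge_periodic_mod d a : (d %| n')%N -> linear_rec a ->
  periodic (d * n) a -> periodic d (edge a).
Proof.
move=> dn rec_a /edge_periodic; rewrite mulnS addnC.
by apply/periodic_cancel/periodicM/linear_edge_periodic.
Qed.

(** Over [d * n] places [a] grows by [n] times the sum of [d] edges, which is 0 because [n] is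
    even. *)
Lemma periodic_odd_turn d a : (0 < d)%N -> (d %| n')%N -> odd n' ->
  linear_rec a -> periodic (d * n) a <-> periodic d (edge a).
Proof.
move=> d0 dn n'_odd rec_a; split; first exact: linear_edge_periodic_mod.
move=> per_a m; rewrite mulnC (edge_periodic_sum _ _ d0 per_a).
by rewrite F2_mulrn /= n'_odd addr0.
Qed.

(** Here [n] is odd, so the [n] equal increments reduce to a single one: a (m + d n) = a (m + d). *)
Lemma periodic_even_turn d a : (0 < d)%N -> (d %| n')%N -> ~~ odd n' ->
  linear_rec a -> periodic (d * n) a <-> periodic d a.
Proof.
move=> d0 dn n'_even rec_a; split=> [per_a m|per_a]; last first.
  by rewrite mulnC; apply: periodicM.
have per_e := linear_edge_periodic_mod dn rec_a per_a.
rewrite -[RHS]per_a mulnC (edge_periodic_sum _ _ d0 per_e) F2_mulrn /= n'_even.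
by rewrite -{1}[d]mul1n (edge_periodic_sum _ _ d0 per_e).
Qed.

(** The edges have periods [2 * e] and [n'], and [n'] is an odd multiple of [e], so [e] is a period
    too. Conversely, the sum of [e] edges is taken an even number of times. *)
Lemma periodic_double_turn e a : (0 < e)%N -> (e %| n')%N -> odd (n' %/ e) ->
  linear_rec a -> periodic (2 * e * n) a <-> periodic e (edge a).
Proof.
move=> e0 en n'e_odd rec_a; have per_n' := linear_edge_periodic rec_a.
split=> [/edge_periodic|] per_a; last first.
  move=> m; rewrite -mulnA [(e * n)%N]mulnC mulnA.
  by rewrite (edge_periodic_sum _ _ e0 per_a) F2_mulrn oddM /= addr0.
have per_2e : periodic (2 * e) (edge a).
  by move: per_a; rewrite mulnS addnC; apply/periodic_cancel/periodicM.
have def_n' : n' = ((n' %/ e)./2 * (2 * e) + e)%N.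
  rewrite -{1}(divnK en) -{1}(odd_double_half (n' %/ e)) n'e_odd.
  by rewrite add1n mulSn addnC mulnA muln2.
by move: per_n'; rewrite {1}def_n'; apply/periodic_cancel/periodicM.
Qed.

Lemma mem_fixptsL k a : linear_rec a ->
  window n' a 0 \in fixpts L k <-> periodic (k * n) a.
Proof.
move=> rec_a; rewrite inE; split=> [/eqP|per_a]; last apply/eqP.
  by apply: (iter_cycle_sds_fix n'_gt0 _ _ k rec_a).1 => // *; rewrite /parity3 add0r.
by apply: (iter_cycle_sds_fix n'_gt0 _ _ k rec_a).2 => // *; rewrite /parity3 add0r.
Qed.

(** One period of [a] can be chosen freely: since [e] divides [n'], every [e]-periodic sequence
    solves the linear recurrence. *)
Lemma card_fixptsL_periodic k e : (0 < e)%N -> (e %| n')%N ->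
  (forall a, linear_rec a -> periodic (k * n) a <-> periodic e a) ->
  #|fixpts L k| = (2 ^ e)%N.
Proof.
move=> e0 en perE.
pose a (w : 'rV['F_2]_e) m := w 0 (Ordinal (ltn_pmod m e0)).
have a_per w : periodic e (a w).
  by move=> m; congr (w _ _); apply: val_inj; rewrite /= modnDr.
have a_rec w : linear_rec (a w).
  apply/edge_orbit_rec/edge_periodic; rewrite -(divnK en).
  exact: periodicM.
have a_small w (j : 'I_e) : a w j = w 0 j.
  by congr (w _ _); apply: val_inj; rewrite /= modn_small.
have win_inj : injective (fun w => window n' (a w) 0).
  move=> w1 w2 eq_w; apply/rowP => j; rewrite -!a_small.
  exact: (orbit_rec_uniq n'_gt0 (a_rec w1) (a_rec w2) eq_w).
have -> : fixpts L k = [set window n' (a w) 0 | w : 'rV_e].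
  apply/setP => x; apply/idP/imsetP => [|[w _ ->]]; last first.
    by apply/(mem_fixptsL _ (a_rec w))/perE.
  have [b rec_b <-] := orbit_rec_exists n'_gt0 (fun=> 0) x.
  move/(mem_fixptsL _ rec_b)/(perE _ rec_b) => per_b.
  exists (\row_j b j) => //; apply/rowP => i.
  by rewrite !mxE /= addn0 /a mxE /= (periodic_modn i per_b).
by rewrite card_imset // card_mx card_Fp // mul1n.
Qed.

(** One period of edges can be chosen freely, and the initial value [a 0] supplies the extra bit. *)
Lemma card_fixptsL_edge_periodic k e : (0 < e)%N -> (e %| n')%N ->
  (forall a, linear_rec a -> periodic (k * n) a <-> periodic e (edge a)) ->
  #|fixpts L k| = (2 ^ (e + 1))%N.
Proof.
move=> e0 en perE.
pose b (w : 'rV['F_2]_e) m := w 0 (Ordinal (ltn_pmod m e0)).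
pose a (uw : 'F_2 * 'rV['F_2]_e) m := uw.1 + \sum_(i < m) b uw.2 i.
have a_edge uw m : edge (a uw) m = b uw.2 m.
  by rewrite /edge /a big_ord_recr /= (addrA uw.1) addrA F2_addxx add0r.
have a_per uw : periodic e (edge (a uw)).
  move=> m; rewrite !a_edge.
  by congr (fun_of_matrix uw.2 _ _); apply: val_inj; rewrite /= modnDr.
have a_rec uw : linear_rec (a uw).
  by apply/edge_orbit_rec; rewrite -(divnK en); apply: periodicM.
have b_small w (j : 'I_e) : b w j = w 0 j.
  by congr (w _ _); apply: val_inj; rewrite /= modn_small.
have win_inj : injective (fun uw => window n' (a uw) 0).
  move=> uw1 uw2 eq_w.
  have {eq_w}eq_a := orbit_rec_uniq n'_gt0 (a_rec uw1) (a_rec uw2) eq_w.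
  rewrite [uw1]surjective_pairing [uw2]surjective_pairing; congr (_, _).
    by have := eq_a 0%N; rewrite /a !big_ord0 !addr0.
  by apply/rowP => j; rewrite -!b_small -!a_edge /edge !eq_a.
have -> : fixpts L k = [set window n' (a uw) 0 | uw : 'F_2 * 'rV_e].
  apply/setP => x; apply/idP/imsetP => [|[uw _ ->]]; last first.
    by apply/(mem_fixptsL _ (a_rec uw))/perE.
  have [g rec_g <-] := orbit_rec_exists n'_gt0 (fun=> 0) x.
  move/(mem_fixptsL _ rec_g)/(perE _ rec_g) => per_g.
  exists (g 0%N, \row_j edge g j) => //; apply/rowP => i.
  rewrite !mxE addn0 -[in LHS](add0n i) edge_sum; congr (_ + _).
  by apply: eq_bigr => j _; rewrite /b mxE /= add0n (periodic_modn j per_g).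
by rewrite card_imset // card_prod card_mx card_Fp // mul1n addn1 expnS.
Qed.

Lemma card_fixptsL_odd d : (0 < d)%N -> (d %| n')%N -> odd n' ->
  #|fixpts L d| = (2 ^ (d + 1))%N.
Proof.
move=> d0 dn n'_odd; apply: card_fixptsL_edge_periodic => // a.
exact: periodic_odd_turn.
Qed.

Lemma card_fixptsL_even d : (0 < d)%N -> (d %| n')%N -> ~~ odd n' ->
  #|fixpts L d| = (2 ^ d)%N.
Proof.
move=> d0 dn n'_even; apply: card_fixptsL_periodic => // a.
exact: periodic_even_turn.
Qed.

(** The hypotheses force [d = 2 * e] with [e] dividing [n']; the quotient is odd, since otherwise
    [d] would divide [n']. *)
Lemma card_fixptsL_double d : (0 < d)%N -> (d %| 2 * n')%N -> ~~ (d %| n')%N ->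
  #|fixpts L d| = (2 ^ (d %/ 2 + 1))%N.
Proof.
move=> d0 d2n dn.
have d_even : (2 %| d)%N.
  rewrite dvdn2; apply: contra dn => d_odd.
  by rewrite -(@Gauss_dvdr d 2) // coprimen2.
have def_d := divnK d_even; set e := (d %/ 2)%N in def_d *.
have e0 : (0 < e)%N by rewrite divn_gt0 // dvdn_leq.
have en : (e %| n')%N by move: d2n; rewrite -def_d mulnC dvdn_pmul2l.
apply: card_fixptsL_edge_periodic => // a.
rewrite -def_d [(e * 2)%N]mulnC; apply: periodic_double_turn => //.
apply: contraR dn; rewrite -dvdn2 => /dvdnP[q def_q].
by rewrite -(divnK en) def_q -mulnA [(2 * e)%N]mulnC def_d dvdn_mull.
Qed.

End LinearCount.

(** * Affine maps in characteristic 2 and points of odd period *)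

Section OddPeriod.
Variables (V : zmodType) (T L : V -> V).
Hypothesis addVV : forall z : V, z + z = 0.
Hypothesis T_add : forall x y, T (x + y) = T x + L y.

(** Points are added two at a time, as T x + T y = L (x + y). *)
Lemma affine_odd_sum q (u : nat -> V) :
  T (\sum_(i < q.*2.+1) u i) = \sum_(i < q.*2.+1) T (u i).
Proof.
elim: q => [|q IH]; first by rewrite !big_ord1.
rewrite doubleS big_ord_recr [in LHS]big_ord_recr /= -addrA T_add IH.
rewrite [RHS]big_ord_recr big_ord_recr /= -addrA; congr (_ + _).
set x := u _; set y := u _.
have -> : T x = T y + L (x + y) by rewrite -T_add addrCA addVV addr0.
by rewrite addrAC addVV add0r.
Qed.

Lemma odd_period_fixpt q x : odd q -> iter q T x = x -> exists y, T y = y.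
Proof.
move=> q_odd Tq; exists (\sum_(i < q) iter i T x).
rewrite -[q]odd_double_half q_odd add1n in Tq *; rewrite affine_odd_sum.
by rewrite big_ord_recr [RHS]big_ord_recl /= -iterS Tq addrC.
Qed.

End OddPeriod.

(** * The system as an affine map *)

Section Affine.
Variables (n : nat) (f : 'I_n -> 'F_2 -> 'F_2 -> 'F_2 -> 'F_2).
Hypothesis f_parity : forall i, f i = parity3 \/ f i = one_plus_parity3.
Local Notation T := (cycle_sds f).
Local Notation L := (cycle_sds (fun _ : 'I_n => parity3)).

Lemma cycle_sds_add x y : T (x + y) = T x + L y.
Proof.
rewrite /cycle_sds; elim: (enum 'I_n) x y => //= i s IH x y.
rewrite -IH; congr (foldl _ _ _); apply/rowP => j; rewrite !mxE.
case: eqP => // _; case: (f_parity i) => ->.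
all: rewrite /parity3 /one_plus_parity3; ring.
Qed.

Lemma iter_cycle_sds_add k x y : iter k T (x + y) = iter k T x + iter k L y.
Proof. by elim: k => //= k ->; rewrite cycle_sds_add. Qed.

(** Translation by [p] carries [fixpts L k] onto [fixpts T k]. *)
Lemma card_fixpts_affine k p : p \in fixpts T k -> #|fixpts T k| = #|fixpts L k|.
Proof.
rewrite inE => /eqP Tp; rewrite -(card_imset (mem (fixpts L k)) (addrI p)).
apply: eq_card => x.
apply/idP/imsetP => [|[y + ->]]; rewrite !inE => /eqP Tx.
  exists (x - p); last by rewrite addrC subrK.
  rewrite inE; apply/eqP/(@addrI _ p).
  by rewrite -{1}Tp -iter_cycle_sds_add addrC subrK Tx.
by rewrite iter_cycle_sds_add Tp Tx.
Qed.

Lemma fixpt_of_odd_multiple k q x : odd q -> iter (q * k) T x = x ->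
  exists y, iter k T y = y.
Proof.
rewrite iterM => q_odd; apply: odd_period_fixpt q_odd.
  by move=> z; apply/rowP => j; rewrite !mxE F2_addxx.
exact: iter_cycle_sds_add.
Qed.

End Affine.

Lemma Per_dvd (X : finType) (T : X -> X) r k x : (0 < r)%N ->
  x \in Per T r -> iter k T x = x -> (r %| k)%N.
Proof.
move=> r0 xr Tk.
have Tr : iter r T x = x by move: xr; rewrite inE => /andP[/eqP].
have [s _ Ts] := least_period r0 Tr.
by move: xr; rewrite (Per_least_period r0 Ts) => /eqP ->; rewrite -Ts Tk.
Qed.

(** * Fixed points of the iterates of the system *)

Section Cycle.
Variables (n' : nat) (f : 'I_n'.+1 -> 'F_2 -> 'F_2 -> 'F_2 -> 'F_2).
Hypothesis n'_gt0 : (0 < n')%N.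
Hypothesis f_parity : forall i, f i = parity3 \/ f i = one_plus_parity3.
Local Notation n := n'.+1.
Local Notation T := (cycle_sds f).
Local Notation L := (cycle_sds (fun _ : 'I_n => parity3)).

(** The constant term of the local function, extended with period [n]; the reduction modulo [n]
    keeps [inord] in range. *)
Definition charge m := f (inord (m %% n)) 0 0 0.

Lemma charge_periodic : periodic n charge.
Proof. by move=> m; rewrite /charge modnDr. Qed.

Lemma chargeE (i : 'I_n) (x y z : 'F_2) : f i x y z = charge i + x + y + z.
Proof.
rewrite /charge modn_small // inord_val; case: (f_parity i) => ->.
all: rewrite /parity3 /one_plus_parity3; ring.
Qed.

Let fixE k a := iter_cycle_sds_fix n'_gt0 chargeE charge_periodic k (a := a).

Lemma iter_cycle_sds_double x : iter (2 * n') T x = x.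
Proof.
have [a rec_a <-] := orbit_rec_exists n'_gt0 charge x.
apply/(fixE _ rec_a); rewrite mul2n.
exact: orbit_periodic rec_a charge_periodic.
Qed.

Lemma fixpt_of_turn x : iter n' T x = x -> exists y, T y = y.
Proof.
move=> Tx; have [n'_odd|n'_even] := boolP (odd n').
  by apply: (@fixpt_of_odd_multiple _ _ f_parity 1 n' x) => //; rewrite muln1.
have [a rec_a def_x] := orbit_rec_exists n'_gt0 charge x.
rewrite -def_x in Tx; move/(fixE _ rec_a): Tx => per_a.
have charge0 := turn_fix_charge rec_a charge_periodic per_a.
have [b rec_b per_b] := charge0_fix n'_gt0 n'_even charge_periodic charge0.
exists (window n' b 0); apply/(fixE 1 rec_b).
by rewrite mul1n.
Qed.

Lemma card_fixpts_odd_dvdn d : (0 < d)%N -> odd_dvdn d (2 * n') ->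
  #|fixpts T d| = (2 ^ (d %/ 2 + 1))%N.
Proof.
move=> d0 /andP[dn q_odd].
have [p Tp] : exists p, iter d T p = p.
  (* Any point would do for 0: all are fixed by the iterate of order [2 * n'], an odd multiple of
     [d]. *)
  apply: (fixpt_of_odd_multiple f_parity (x := 0) q_odd).
  by rewrite divnK // iter_cycle_sds_double.
rewrite (card_fixpts_affine f_parity (p := p)) ?inE ?Tp //.
rewrite card_fixptsL_double //; apply: contraL q_odd => /dvdnP[q ->].
by rewrite mulnA mulnK // oddM.
Qed.

(** An even quotient means that [d] divides [n'], so a fixed point of the [d]-th iterate is one of
    the [n']-th and would yield a fixed point of [T]. *)
Lemma fixpts_even_quotient d : (d %| 2 * n')%N -> ~~ odd (2 * n' %/ d) ->
  ~ (exists x, T x = x) -> fixpts T d = set0.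
Proof.
move=> dn; rewrite -dvdn2 => /dvdnP[q def_q] no_fix.
apply/setP => x; rewrite !inE; apply/negP => /eqP Tx; apply: no_fix.
apply: (@fixpt_of_turn x); have def_n' : (q * d)%N = n'.
  by apply/eqP; rewrite -(eqn_pmul2l (isT : 0 < 2)%N) -{1}(divnK dn) def_q; lia.
by have := iter_mul_fix q Tx; rewrite def_n'.
Qed.

Lemma card_Per0 r : (0 < r)%N -> ~~ (r %| 2 * n')%N -> #|Per T r| = 0%N.
Proof.
move=> r0 rn; apply/eqP; rewrite cards_eq0 -subset0; apply/subsetP => x xr.
by rewrite (Per_dvd r0 xr (iter_cycle_sds_double x)) in rn.
Qed.

(** By counting: the [n']-th iterate has 2^(n' + 1) = 2^n fixed points, which is the whole space. *)
Lemma iter_cycle_sds_turn x0 x : T x0 = x0 -> odd n' -> iter n' T x = x.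
Proof.
move=> Tx0 n'_odd.
have x0_fix : x0 \in fixpts T n' by rewrite inE iter_fix.
suff /setP/(_ x) : fixpts T n' = setT by rewrite !inE => /eqP.
apply/eqP; rewrite eqEcard subsetT cardsT card_mx card_Fp // mul1n.
by rewrite /= (card_fixpts_affine f_parity x0_fix) card_fixptsL_odd ?dvdnn // addn1.
Qed.

End Cycle.

(** * Assembly of the two counts *)

Theorem theorem4p9 (n r : nat) (f : 'I_n -> 'F_2 -> 'F_2 -> 'F_2 -> 'F_2)
    (hn : (3 <= n)%N) (hr : (0 < r)%N)
    (hf : forall i : 'I_n, f i = parity3 \/ f i = one_plus_parity3) :
  ((exists x : 'rV['F_2]_n, cycle_sds f x = x) ->
     (#|Per (cycle_sds f) r|%:Z : int) =
       if (r %| n - 1)%N && (n == 0 %[mod 2])%N then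
         \sum_(d <- divisors r) moebius (r %/ d) * 2 ^+ (d + 1)
       else if (r %| 2 * n - 2)%N && (n == 1 %[mod 2])%N then
         \sum_(d <- divisors r) moebius (r %/ d) * xi n d
       else 0) /\
  (~ (exists x : 'rV['F_2]_n, cycle_sds f x = x) ->
     (#|Per (cycle_sds f) r|%:Z : int) =
       if odd_dvdn r (2 * n - 2) then
         \sum_(d <- divisors r | odd_dvdn d r)
           moebius (r %/ d) * 2 ^+ (d %/ 2 + 1)
       else 0).
Proof.
case: n f hn hf => [//|n'] f; rewrite ltnS subSS subn0 => n'1 hf.
have n'0 : (0 < n')%N by apply: leq_trans n'1.
have -> : (2 * n'.+1 - 2 = 2 * n')%N by rewrite mulnS addKn.
have exp2E k : (2 ^ k)%N%:Z = 2 ^+ k :> int by rewrite -[LHS]natz natrX.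
rewrite !modn2 /=.
split=> [[x0 Tx0]|no_fix].
  have cardE d :
      #|fixpts (cycle_sds f) d| = #|fixpts (cycle_sds (fun _ : 'I_n'.+1 => parity3)) d|.
    by apply: (card_fixpts_affine hf (p := x0)); rewrite inE iter_fix.
  (* Since n = n' + 1, an even [n'] is the case of odd [n]. *)
  have [n'_odd|n'_even] := boolP (odd n'); last first.
    rewrite /= andbF /= andbT; case: ifP => [rn|/negbT rn]; last first.
      by rewrite card_Per0.
    rewrite card_Per // big_seq [RHS]big_seq; apply: eq_bigr => d.
    rewrite -(dvdn_divisors _ hr) => dr; have d0 := dvdn_gt0 hr dr.
    congr (_ * _); rewrite cardE /xi subSS subn0.
    case: ifP => [dn|/negbT dn]; first by rewrite card_fixptsL_even.
    by rewrite card_fixptsL_double ?exp2E // (dvdn_trans dr rn).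
  rewrite /= andbT andbF; case: ifP => [rn|/negbT rn]; last first.
    suff -> : Per (cycle_sds f) r = set0 by rewrite cards0.
    apply/eqP; rewrite -subset0; apply/subsetP => x xr.
    by rewrite (Per_dvd hr xr (iter_cycle_sds_turn n'0 hf x Tx0 n'_odd)) in rn.
  rewrite card_Per // big_seq [RHS]big_seq; apply: eq_bigr => d.
  rewrite -(dvdn_divisors _ hr) => dr; have d0 := dvdn_gt0 hr dr.
  by rewrite cardE card_fixptsL_odd ?exp2E // (dvdn_trans dr rn).
have [rn|rn] := boolP (r %| 2 * n')%N; last first.
  by rewrite /odd_dvdn (negPf rn) card_Per0.
rewrite /odd_dvdn rn /=; case: ifP => [q_odd|/negbT q_even]; last first.
  suff -> : Per (cycle_sds f) r = set0 by rewrite cards0.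
  apply/eqP; rewrite -subset0 -(fixpts_even_quotient n'0 hf rn q_even no_fix).
  by apply/subsetP => x; rewrite !inE => /andP[].
rewrite card_Per // [RHS]big_mkcond big_seq [RHS]big_seq; apply: eq_bigr => d.
rewrite -(dvdn_divisors _ hr) => dr; have d0 := dvdn_gt0 hr dr.
have dn := dvdn_trans dr rn.
(* As the quotient of [2 * n'] by [r] is odd, that of [2 * n'] by [d] has the parity of [r %/ d];
   divisors with [r %/ d] even thus contribute 0. *)
have quotE : (2 * n' %/ d = (2 * n' %/ r) * (r %/ d))%N.
  by rewrite muln_divA // divnK.
rewrite dr /=; case: ifP => [rd_odd|rd_even].
  by rewrite card_fixpts_odd_dvdn ?exp2E // /odd_dvdn dn quotE oddM q_odd.
rewrite fixpts_even_quotient ?cards0 ?mulr0 //.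
by rewrite quotE oddM q_odd rd_even.
Qed.
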